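(* Let $k\ge2$ be an integer. A series-parallel graph $G$ is $C_{2k+1}$-critical if and only if $G$ is isomorphic (as a graph) to a parallel sum $G_1\,\|\,G_2$ with $G_1\in\mathcal{F}_S^A$ and $G_2\in\mathcal{F}_T^B$ for some nonempty symmetric subsets $S,T,A,B$ of $\mathbb{Z}_{2k+1}$ such that $S\cap T=\emptyset$, $A\subseteq T$ and $B\subseteq S$.
   Context: We take $V(C_{2k+1})=\mathbb{Z}_{2k+1}$ with $u,v$ adjacent iff $u-v=\pm1$; a $C_{2k+1}$-colouring of $G$ is a map $\phi:V(G)\to\mathbb{Z}_{2k+1}$ with $\phi(u)-\phi(v)=\pm1$ for every edge $uv$. $G$ is $C_{2k+1}$-critical if it has no $C_{2k+1}$-colouring but every proper subgraph has one. A subset of $\mathbb{Z}_{2k+1}$ is symmetric if closed under multiplication by $-1$. A 2-terminal graph $(G,s,t)$ is a graph with two distinct distinguished vertices (terminals). The serial sum $(G_1,s_1,t_1)+(G_2,s_2,t_2)$ identifies $t_1$ with $s_2$, with terminals $s_1,t_2$; the parallel sum $(G_1,s_1,t_1)\,\|\,(G_2,s_2,t_2)$ identifies $s_1$ with $s_2$ (terminal $s$) and $t_1$ with $t_2$ (terminal $t$). $G$ is series-parallel if for some terminals $s,t$, $(G,s,t)$ can be built from single edges by serial and parallel sums. For nonempty $S\subseteq\mathbb{Z}_{2k+1}$, $(G,s,t)$ is $S$-forcing if $S=\{x:\exists$ a $C_{2k+1}$-colouring $\phi$ of $G$ with $\phi(s)=0,\phi(t)=x\}$, and minimally $S$-forcing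 if it is $S$-forcing and no proper subgraph $(G',s,t)$ is $S$-forcing. For disjoint nonempty symmetric $S,T\subseteq\mathbb{Z}_{2k+1}$, $\mathcal{F}_S^T$ is the family of minimally $S$-forcing 2-terminal series-parallel graphs $(G,s,t)$ such that for every edge $e\in E(G)$ there exist $x\in T$ and a $C_{2k+1}$-colouring $\phi$ of $G-e$ with $\phi(s)=0$ and $\phi(t)=x$. *)

(* Defs.v *)
From mathcomp Require Import all_boot all_algebra.
Set Implicit Arguments. Unset Strict Implicit. Unset Printing Implicit Defensive.
Import GRing.Theory.
Local Open Scope ring_scope.

(* Finite graphs, parallel edges allowed (a parallel sum of two single edges
   has two of them). The orientation given by [src] and [tgt] is immaterial:
   colourings and isomorphisms ignore it. *)
Record graph := Graph {
  vert : finType;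
  edge : finType;
  src : edge -> vert;
  tgt : edge -> vert }.

Definition joins (G : graph) (e : edge G) (u v : vert G) : Prop :=
  (src e = u /\ tgt e = v) \/ (src e = v /\ tgt e = u).

Definition is_iso (G H : graph) (f : vert G -> vert H) (g : edge G -> edge H) : Prop :=
  [/\ bijective f, bijective g
    & forall e, joins (g e) (f (src e)) (f (tgt e))].

Definition isomorphic (G H : graph) : Prop := exists f g, @is_iso G H f g.

Record subgraph (G : graph) := Subgraph {
  sverts : {set vert G};
  sedges : {set edge G};
  src_sverts : forall e, e \in sedges -> src e \in sverts;
  tgt_sverts : forall e, e \in sedges -> tgt e \in sverts }.

Definition graph_of_subgraph (G : graph) (H : subgraph G) : graph :=
  @Graph {x : vert G | x \in sverts H} {e : edge G | e \in sedges H}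
    (fun e => exist _ (src (val e)) (src_sverts (valP e)))
    (fun e => exist _ (tgt (val e)) (tgt_sverts (valP e))).

Coercion graph_of_subgraph : subgraph >-> graph.

Definition proper_subgraph (G : graph) (H : subgraph G) : Prop :=
  sverts H != setT \/ sedges H != setT.

Definition edge_deletion (G : graph) (e : edge G) : subgraph G :=
  @Subgraph G setT (setT :\ e) (fun d _ => in_setT (src d)) (fun d _ => in_setT (tgt d)).

(* 'Z_n is the ring of integers mod n only for n > 1, so what follows is
   meaningful for k > 0 only. *)
Definition coloring (k : nat) (G : graph) (phi : vert G -> 'Z_(2 * k + 1)) : Prop :=
  forall e : edge G, phi (src e) - phi (tgt e) = 1 \/ phi (src e) - phi (tgt e) = -1.

Definition colorable (k : nat) (G : graph) : Prop :=
  exists phi : vert G -> 'Z_(2 * k + 1), coloring phi.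

Definition critical (k : nat) (G : graph) : Prop :=
  ~ colorable k G /\ forall H : subgraph G, proper_subgraph H -> colorable k H.

Definition symmetric_set (k : nat) (S : {set 'Z_(2 * k + 1)}) : Prop :=
  forall x, x \in S -> - x \in S.

Record tgraph := TGraph {
  tgraph_graph :> graph;
  term_s : vert tgraph_graph;
  term_t : vert tgraph_graph;
  term_neq : term_s != term_t }.

Definition tisomorphic (G H : tgraph) : Prop :=
  exists f g, [/\ @is_iso G H f g, f (term_s G) = term_s H & f (term_t G) = term_t H].

Definition sub_tgraph (G : tgraph) (H : subgraph G)
    (hs : term_s G \in sverts H) (ht : term_t G \in sverts H) : tgraph :=
  @TGraph H (exist _ (term_s G) hs) (exist _ (term_t G) ht) (term_neq G).

Definition tdelete (G : tgraph) (e : edge G) : tgraph :=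
  @sub_tgraph G (edge_deletion e) (in_setT (term_s G)) (in_setT (term_t G)).

Section Glue.
Variables (G1 G2 : graph) (P : {set vert G2}) (h : vert G2 -> vert G1).

(* Disjoint union of G1 and G2 in which each x in P is identified with h x. *)
Definition glue_vert : finType := (vert G1 + {x : vert G2 | x \notin P})%type.

Definition glue_inr (x : vert G2) : glue_vert :=
  if insub x is Some y then inr y else inl (h x).

Definition glue : graph :=
  @Graph glue_vert (edge G1 + edge G2)%type
    (fun e => match e with inl e1 => inl (src e1) | inr e2 => glue_inr (src e2) end)
    (fun e => match e with inl e1 => inl (tgt e1) | inr e2 => glue_inr (tgt e2) end).

Lemma glue_inr_notin x (hx : x \notin P) : glue_inr x = inr (exist _ x hx).
Proof. by rewrite /glue_inr insubT. Qed.
End Glue.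

Section Sums.
Variables G1 G2 : tgraph.

Definition serial_graph : graph :=
  @glue G1 G2 [set term_s G2] (fun=> term_t G1).

Definition serial_s : vert serial_graph := inl (term_s G1).
Definition serial_t : vert serial_graph :=
  glue_inr [set term_s G2] (fun=> term_t G1) (term_t G2).

Lemma serial_neq : serial_s != serial_t.
Proof.
rewrite /serial_t glue_inr_notin // inE eq_sym; exact: term_neq.
Qed.

Definition serial_sum : tgraph := TGraph serial_neq.

Definition parallel_graph : graph :=
  @glue G1 G2 [set term_s G2; term_t G2]
    (fun x => if x == term_s G2 then term_s G1 else term_t G1).

Definition parallel_s : vert parallel_graph := inl (term_s G1).
Definition parallel_t : vert parallel_graph := inl (term_t G1).

Lemma parallel_neq : parallel_s != parallel_t.
Proof. exact: term_neq. Qed.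

Definition parallel_sum : tgraph := TGraph parallel_neq.
End Sums.

Definition single_edge : tgraph :=
  @TGraph (@Graph bool unit (fun=> false) (fun=> true)) false true isT.

Inductive tseries_parallel : tgraph -> Prop :=
| sp_edge : tseries_parallel single_edge
| sp_serial G1 G2 : tseries_parallel G1 -> tseries_parallel G2 ->
    tseries_parallel (serial_sum G1 G2)
| sp_parallel G1 G2 : tseries_parallel G1 -> tseries_parallel G2 ->
    tseries_parallel (parallel_sum G1 G2)
| sp_iso G H : tseries_parallel G -> tisomorphic G H -> tseries_parallel H.

Definition series_parallel (G : graph) : Prop :=
  exists (s t : vert G) (hst : s != t), tseries_parallel (TGraph hst).

Definition attains (k : nat) (G : tgraph) (x : 'Z_(2 * k + 1)) : Prop :=
  exists phi : vert G -> 'Z_(2 * k + 1),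
    [/\ coloring phi, phi (term_s G) = 0 & phi (term_t G) = x].

Definition forcing (k : nat) (S : {set 'Z_(2 * k + 1)}) (G : tgraph) : Prop :=
  S != set0 /\ forall x, x \in S <-> attains G x.

Definition minimally_forcing (k : nat) (S : {set 'Z_(2 * k + 1)}) (G : tgraph) : Prop :=
  forcing S G /\
  forall (H : subgraph G) (hs : term_s G \in sverts H) (ht : term_t G \in sverts H),
    proper_subgraph H -> ~ forcing S (sub_tgraph hs ht).

Definition forcing_family (k : nat) (S T : {set 'Z_(2 * k + 1)}) (G : tgraph) : Prop :=
  [/\ [/\ S != set0, T != set0, symmetric_set S, symmetric_set T & [disjoint S & T]],
      tseries_parallel G,
      minimally_forcing S G
    & forall e : edge G, exists2 x, x \in T & attains (tdelete e) x].

(* Main.v *)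
Require Import Defs.
From mathcomp Require Import all_boot all_algebra.
Set Implicit Arguments. Unset Strict Implicit. Unset Printing Implicit Defensive.

(* In a graph without isolated vertices every proper subgraph misses an edge, so
   criticality and minimality only concern edge deletions. A critical graph is
   not a single edge, and not a serial sum because colourings of the two summands
   can be translated to agree at the cut vertex; so it is a parallel sum
   G1 || G2. Taking for S and T the sets of values forced by G1 and G2, G1 || G2
   is colourable iff S and T meet, and G1 || G2 minus an edge of G1 is colourable
   iff that deletion makes G1 attain a value of T; thus A = T and B = S work. *)

Import GRing.Theory.

(** * Colourings constrained on a chosen set of edges *)

Section Coloring.
Local Open Scope ring_scope.
Variable k : nat.
Notation Z := 'Z_(2 * k + 1).
Implicit Types (G H : graph) (x : Z).

(** The predicate [D] stands for a spanning subgraph, so deletions keep the vertex type of [G] and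
    are compared by inclusion of predicates. *)
Definition colors G (D : pred (edge G)) (phi : vert G -> Z) : Prop :=
  forall e, D e -> phi (src e) - phi (tgt e) = 1 \/ phi (src e) - phi (tgt e) = -1.

Definition colorable_on G (D : pred (edge G)) : Prop := exists phi, colors D phi.

(** Recording the difference of the terminal values, rather than fixing the value 0 at the first
    terminal, makes the notion invariant under translation. *)
Definition attains_on (G : tgraph) (D : pred (edge G)) x : Prop :=
  exists2 phi, colors D phi & phi (term_t G) - phi (term_s G) = x.

Definition edge_critical G : Prop :=
  ~ colorable_on (@predT (edge G)) /\ forall e : edge G, colorable_on (predC1 e).

Definition no_isolated G : Prop :=
  forall v : vert G, exists e : edge G, src e = v \/ tgt e = v.

Lemma colorsW G (D D' : pred (edge G)) phi :
  subpred D' D -> colors D phi -> colors D' phi.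
Proof. by move=> sD c e /sD /c. Qed.

Lemma colors_shift G (D : pred (edge G)) phi a :
  colors D phi -> colors D (fun v => phi v + a).
Proof. by move=> c e /c; rewrite opprD addrACA subrr addr0. Qed.

(** Negation is an automorphism of the cycle; this is why sets of attained values are symmetric. *)
Lemma colors_opp G (D : pred (edge G)) phi :
  colors D phi -> colors D (fun v => - phi v).
Proof.
move=> c e /c [] E; rewrite -opprD E; first by right.
by left; rewrite opprK.
Qed.

Lemma coloring_colors G (phi : vert G -> Z) :
  coloring phi <-> colors predT phi.
Proof. by split=> [c e _ | c e]; apply: c. Qed.

Lemma colorableE G : colorable k G <-> colorable_on (@predT (edge G)).
Proof. by split=> -[phi /coloring_colors c]; exists phi. Qed.

Lemma attains_onW (G : tgraph) (D D' : pred (edge G)) x :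
  subpred D' D -> attains_on D x -> attains_on D' x.
Proof. by move=> sD [phi c E]; exists phi => //; apply: colorsW c. Qed.

Lemma attains_onN (G : tgraph) (D : pred (edge G)) x :
  attains_on D x -> attains_on D (- x).
Proof.
by case=> phi c <-; exists (fun v => - phi v); [apply: colors_opp | rewrite opprD].
Qed.

Lemma attainsE (G : tgraph) x : attains G x <-> attains_on (@predT (edge G)) x.
Proof.
split=> [[phi [/coloring_colors c s0 <-]] | [phi c <-]].
  by exists phi => //; rewrite s0 subr0.
exists (fun v => phi v - phi (term_s G)); split=> //; last by rewrite subrr.
exact/coloring_colors/colors_shift.
Qed.

(** * Passing between subgraphs and edge predicates *)

Definition extend G (H : subgraph G) (phi : vert H -> Z) (v : vert G) : Z :=
  if insub v is Some u then phi u else 0.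

Lemma extendE G (H : subgraph G) (phi : vert H -> Z) v (hv : v \in sverts H) :
  extend phi v = phi (exist _ v hv).
Proof. by rewrite /extend insubT. Qed.

(** The default value 0 of [extend] is never read here, since both ends of an edge of [H] lie in
    [sverts H]. *)
Lemma colors_extend G (H : subgraph G) (phi : vert H -> Z) :
  coloring phi -> colors (mem (sedges H)) (extend phi).
Proof.
by move=> c e he; have := c (exist _ e he); rewrite /= -!extendE.
Qed.

Lemma colors_restrict G (H : subgraph G) (phi : vert G -> Z) :
  colors (mem (sedges H)) phi -> @coloring k H (fun v => phi (val v)).
Proof. by move=> c [e he]; exact: (c e he). Qed.

Lemma colorable_subgraph G (H : subgraph G) :
  colorable k H <-> colorable_on (mem (sedges H)).
Proof.
split=> -[phi c]; first by exists (extend phi); apply: colors_extend.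
by eexists; apply: colors_restrict c.
Qed.

Lemma attains_subgraph (G : tgraph) (H : subgraph G) (hs : term_s G \in sverts H)
    (ht : term_t G \in sverts H) x :
  attains (sub_tgraph hs ht) x <-> attains_on (mem (sedges H)) x.
Proof.
apply: (iff_trans (attainsE _ _)); split=> -[phi c E].
  exists (extend phi); first exact/colors_extend/coloring_colors.
  by rewrite (extendE _ hs) (extendE _ ht).
exists (fun v => phi (val v)); last by [].
exact/coloring_colors/colors_restrict.
Qed.

Lemma sedges_deletion G (e : edge G) : mem (sedges (edge_deletion e)) =1 predC1 e.
Proof. by move=> d; rewrite /= !inE andbT. Qed.

Lemma attains_tdelete (G : tgraph) (e : edge G) x :
  attains (tdelete e) x <-> attains_on (predC1 e) x.
Proof.
apply: (iff_trans (attains_subgraph _ _ _)).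
by split; apply: attains_onW => d; rewrite sedges_deletion.
Qed.

(** A subgraph with all the edges contains all their ends, and these exhaust the vertices. *)
Lemma proper_missing_edge G (H : subgraph G) :
  no_isolated G -> proper_subgraph H -> exists e, e \notin sedges H.
Proof.
move=> ni pH; have [/subsetP sE | /subsetPn [e _]] := boolP (setT \subset sedges H);
  last by exists e.
have all e : e \in sedges H by rewrite sE ?inE.
case: pH => /negP []; apply/eqP/setP => v; rewrite inE; last exact: all.
by have [e [<-|<-]] := ni v; [apply: src_sverts | apply: tgt_sverts].
Qed.

Lemma criticalE G : no_isolated G -> critical k G <-> edge_critical G.
Proof.
move=> ni; split=> -[nc cr]; split.
- by move/colorableE.
- move=> e; have /colorable_subgraph [phi c] : colorable k (edge_deletion e).
    apply: cr; right; apply/negP => /eqP /setP /(_ e).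
    by rewrite !inE eqxx.
  by exists phi; apply: colorsW c => d; rewrite sedges_deletion.
- by move/colorableE.
(* [H] avoids some edge [e], so a colouring of [G] minus [e] restricts to [H]. *)
- move=> H /(proper_missing_edge ni) [e he]; apply/colorable_subgraph.
  have [phi c] := cr e; exists phi; apply: colorsW c => d /= hd.
  by apply: contraNneq he => <-.
Qed.

(** * Invariance under isomorphism *)

Lemma isomorphic_sym G H : isomorphic G H -> isomorphic H G.
Proof.
case=> f [g [[f' fK f'K] [g' gK g'K] j]]; exists f', g'; split.
- by exists f.
- by exists g.
move=> e; have := j (g' e); rewrite g'K.
by case=> -[-> ->]; rewrite !fK; [left | right].
Qed.

Lemma colorable_on_iso G H (f : vert G -> vert H) (g : edge G -> edge H)
    (D : pred (edge H)) :
  is_iso f g -> colorable_on D -> colorable_on (fun e => D (g e)).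
Proof.
case=> _ _ j [phi c]; exists (fun v => phi (f v)) => e /c.
(* [g] may reverse an edge, which swaps the differences 1 and -1. *)
case: (j e) => -[-> ->] // [] E; rewrite -opprB E; first by right.
by left; rewrite opprK.
Qed.

Lemma edge_critical_iso G H : isomorphic G H -> edge_critical H -> edge_critical G.
Proof.
move=> iso [nc cr]; split.
  (* A colouring of [G], pulled back along the inverse isomorphism, would colour [H]. *)
  by have [f [g i]] := isomorphic_sym iso; move/(colorable_on_iso i).
have [f [g i]] := iso => e; have [phi c] := colorable_on_iso i (cr (g e)).
exists phi; apply: colorsW c => d /=.
by case: i => _ /bij_inj gI _; rewrite (inj_eq gI).
Qed.

Lemma isomorphic_trans G H K : isomorphic G H -> isomorphic H K -> isomorphic G K.
Proof.
case=> f [g [bf bg j]] [f' [g' [bf' bg' j']]].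
exists (f' \o f), (g' \o g); split; try exact: bij_comp.
move=> e /=; have := j' (g e).
by rewrite /joins; case: (j e) => -[<- <-] [] [-> ->]; auto.
Qed.

Lemma no_isolated_iso G H : isomorphic G H -> no_isolated H -> no_isolated G.
Proof.
move=> /isomorphic_sym [f [g [[f' fK f'K] _ j]]] ni v.
have [e he] := ni (f' v); exists (g e).
by case: (j e) he => -[-> ->] [] ->; rewrite f'K; auto.
Qed.

(** * Gluing, serial and parallel sums *)

Lemma no_isolated_glue G1 G2 (P : {set vert G2}) (h : vert G2 -> vert G1) :
  no_isolated G1 -> no_isolated G2 -> no_isolated (glue P h).
Proof.
move=> n1 n2 [v | [v hv]].
  by have [e [<- | <-]] := n1 v; exists (inl e); [left | right].
have [e E] := n2 v; exists (inr e).
by case: E => /= ->; rewrite (glue_inr_notin h hv); auto.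
Qed.

Lemma tseries_parallel_no_isolated (G : tgraph) : tseries_parallel G -> no_isolated G.
Proof.
elim=> {G} [|G1 G2 _ n1 _ n2|G1 G2 _ n1 _ n2|G H _ n [f [g [i _ _]]]].
- by case; exists tt; [right | left].
- exact: no_isolated_glue.
- exact: no_isolated_glue.
- by apply: no_isolated_iso n; apply: isomorphic_sym; exists f, g.
Qed.

Lemma colors_glue G1 G2 (P : {set vert G2}) (h : vert G2 -> vert G1)
    (D : pred (edge (glue P h))) (phi1 : vert G1 -> Z) (phi2 : vert G2 -> Z) :
  {in P, forall v, phi2 v = phi1 (h v)} ->
  colors (fun e => D (inl e)) phi1 -> colors (fun e => D (inr e)) phi2 ->
  colorable_on D.
Proof.
move=> agree c1 c2.
pose phi (v : vert (glue P h)) :=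
  match v with inl u => phi1 u | inr u => phi2 (val u) end.
have phiE v : phi (glue_inr P h v) = phi2 v.
  by rewrite /glue_inr; case: insubP => /= [u _ -> //|/negPn /agree ->].
by exists phi; case=> e he /=; rewrite ?phiE; [apply: c1 | apply: c2].
Qed.

Lemma colorable_serial (G1 G2 : tgraph) (D : pred (edge (serial_sum G1 G2))) :
  colorable_on (fun e : edge G1 => D (inl e)) ->
  colorable_on (fun e : edge G2 => D (inr e)) -> colorable_on D.
Proof.
move=> [phi1 c1] [phi2 c2].
(* [phi2] is translated to agree with [phi1] at the cut vertex. *)
apply: (colors_glue (phi1 := phi1)
  (phi2 := fun v => phi2 v + (phi1 (term_t G1) - phi2 (term_s G2)))) => //.
  by move=> v /set1P ->; rewrite addrC subrK.
exact: colors_shift.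
Qed.

(** Colourings of the summands can be translated to agree at the first terminal; they then agree at
    the second exactly when their terminal differences are equal. *)
Lemma colorable_parallel (G1 G2 : tgraph) (D : pred (edge (parallel_sum G1 G2))) :
  colorable_on D <->
  exists x, attains_on (fun e : edge G1 => D (inl e)) x /\
            attains_on (fun e : edge G2 => D (inr e)) x.
Proof.
set h := fun v : vert G2 => if v == term_s G2 then term_s G1 else term_t G1.
split=> [[phi c] | [x [[phi1 c1 E1] [phi2 c2 E2]]]].
  exists (phi (term_t (parallel_sum G1 G2)) - phi (term_s (parallel_sum G1 G2))).
  split; first by exists (fun v => phi (inl v)) => // e /c.
  exists (fun v => phi (glue_inr [set term_s G2; term_t G2] h v)); first by move=> e /c.
  (* Both terminals of [G2] lie in the identified set, so [glue_inr] sends them to their images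
     under [h]. *)
  rewrite /glue_inr !insubN ?inE ?eqxx ?orbT // /h eqxx.
  by rewrite eq_sym (negPf (term_neq G2)).
apply: (colors_glue (phi1 := phi1)
  (phi2 := fun v => phi2 v + (phi1 (term_s G1) - phi2 (term_s G2)))) => //.
  move=> v /set2P [] ->; rewrite ?eqxx; first by rewrite addrC subrK.
  rewrite eq_sym (negPf (term_neq G2)) addrCA E2 -E1.
  by rewrite addrC subrK.
exact: colors_shift.
Qed.

(** * Decomposing critical graphs, and the sets they force *)

Lemma edge_critical_parallel (G : tgraph) :
  tseries_parallel G -> edge_critical G ->
  exists G1 G2 : tgraph, [/\ tseries_parallel G1, tseries_parallel G2
                  & isomorphic G (parallel_sum G1 G2)].
Proof.
elim=> {G} [|G1 G2 sp1 _ sp2 _|G1 G2 sp1 _ sp2 _|G H _ IH [f [g [i _ _]]]].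
- case=> nc _; case: nc.
  (* The ends receive 0 and 1, with difference -1. *)
  by exists (fun b : bool => b%:R) => e _; right; rewrite /= sub0r.
- case=> nc cr; case: nc; apply: colorable_serial.
    (* Deleting an edge of [G2] leaves [G1] whole, so [G1] is colourable; the same holds with the
       roles exchanged. *)
    have [e _] := tseries_parallel_no_isolated sp2 (term_s G2).
    have [phi c] := cr (inr e); exists (fun v => phi (inl v)).
    by move=> d _; apply: (c (inl d)).
  have [e _] := tseries_parallel_no_isolated sp1 (term_s G1).
  have [phi c] := cr (inl e).
  exists (fun v => phi (glue_inr [set term_s G2] (fun=> term_t G1) v)).
  by move=> d _; apply: (c (inr d)).
- move=> _; exists G1, G2; split=> //.
  by exists id, id; split; [exists id | exists id | left].
- have iso : isomorphic G H by exists f, g.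
  move/(edge_critical_iso iso) => /IH [G1 [G2 [sp1 sp2 iso']]].
  exists G1, G2; split=> //.
  by apply: isomorphic_trans iso'; apply: isomorphic_sym.
Qed.

(** Boolean quantification over finite functions yields a finite set; it is the only [S] for which
    [G] can be [S]-forcing. *)
Definition values (G : tgraph) : {set Z} :=
  [set x | [exists phi : {ffun vert G -> Z},
     [forall e, (phi (src e) - phi (tgt e) == 1) || (phi (src e) - phi (tgt e) == -1)]
     && (phi (term_t G) - phi (term_s G) == x)]].

Lemma valuesP (G : tgraph) x : x \in values G <-> attains_on (@predT (edge G)) x.
Proof.
rewrite inE; split.
  case/existsP=> phi /andP [/forallP c /eqP E]; exists phi => // e _.
  by case/orP: (c e) => /eqP; [left | right].
case=> phi c E; apply/existsP; exists (finfun phi); rewrite !ffunE E eqxx andbT.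
by apply/forallP => e; rewrite !ffunE; case: (c e isT) => ->; rewrite eqxx ?orbT.
Qed.

Lemma values_symmetric (G : tgraph) : symmetric_set (values G).
Proof. by move=> x /valuesP /attains_onN /valuesP. Qed.

(** Minimality follows from the deletion condition: a proper subgraph misses an edge, hence attains
    a value of [T], which lies outside [values G]. *)
Lemma forcing_family_values (G : tgraph) (T : {set Z}) :
  tseries_parallel G -> values G != set0 -> T != set0 -> symmetric_set T ->
  [disjoint values G & T] ->
  (forall e : edge G, exists2 x, x \in T & attains_on (predC1 e) x) ->
  forcing_family (values G) T G.
Proof.
move=> sp S0 T0 symT dis del; split=> //; first by split=> //; apply: values_symmetric.
  split; first by split=> // x; split=> [/valuesP/attainsE | /attainsE/valuesP].
  move=> H hs ht /(proper_missing_edge (tseries_parallel_no_isolated sp)) [e he] [_ fH].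
  have [x xT ax] := del e.
  suff xS : x \in values G by rewrite (disjointFr dis xS) in xT.
  apply/fH/attains_subgraph; apply: attains_onW ax => d /= hd.
  by apply: contraNneq he => <-.
by move=> e; have [x xT ax] := del e; exists x => //; apply/attains_tdelete.
Qed.

Lemma edge_critical_forcing (G1 G2 : tgraph) :
  tseries_parallel G1 -> tseries_parallel G2 -> edge_critical (parallel_sum G1 G2) ->
  [/\ values G1 != set0, values G2 != set0, [disjoint values G1 & values G2],
      forcing_family (values G1) (values G2) G1
    & forcing_family (values G2) (values G1) G2].
Proof.
move=> sp1 sp2 [nc cr].
have dis : [disjoint values G1 & values G2].
  apply/pred0P => x; apply/negP => /andP [/valuesP a1 /valuesP a2].
  by apply/nc/colorable_parallel; exists x.
(* [G2] stays whole when [e] is deleted from [G1], so the common value lies in [values G2]. *)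
have del1 (e : edge G1) : exists2 x, x \in values G2 & attains_on (predC1 e) x.
  by have /colorable_parallel [x [a1 /valuesP a2]] := cr (inl e); exists x.
have del2 (e : edge G2) : exists2 x, x \in values G1 & attains_on (predC1 e) x.
  by have /colorable_parallel [x [/valuesP a1 a2]] := cr (inr e); exists x.
have S0 : values G1 != set0.
  (* [G2] has an edge, and its deletion provides a value of the intact [G1]. *)
  have [e _] := tseries_parallel_no_isolated sp2 (term_s G2).
  by have [x xS _] := del2 e; apply/set0Pn; exists x.
have T0 : values G2 != set0.
  have [e _] := tseries_parallel_no_isolated sp1 (term_s G1).
  by have [x xT _] := del1 e; apply/set0Pn; exists x.
split=> //; apply: forcing_family_values => //; try exact: values_symmetric.
by rewrite disjoint_sym.
Qed.

(** A value of [A] gained by deleting an edge of [G1] lies in [T], so [G2] attains it as well and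
    the two colourings glue; likewise for [B]. *)
Lemma forcing_edge_critical (S T A B : {set Z}) (G1 G2 : tgraph) :
  [disjoint S & T] -> A \subset T -> B \subset S ->
  forcing_family S A G1 -> forcing_family T B G2 ->
  edge_critical (parallel_sum G1 G2).
Proof.
move=> dis /subsetP AT /subsetP BS [_ _ [[_ fS] _] delA] [_ _ [[_ fT] _] delB].
split.
  case/colorable_parallel=> x [/attainsE /fS xS /attainsE /fT xT].
  by rewrite (disjointFr dis xS) in xT.
case=> e; apply/colorable_parallel.
  have [x /AT /fT /attainsE a2 /attains_tdelete a1] := delA e.
  by exists x.
have [x /BS /fS /attainsE a1 /attains_tdelete a2] := delB e.
by exists x.
Qed.
End Coloring.

Theorem theorem4p2 (k : nat) (hk : 2 <= k) (G : graph) (hG : series_parallel G) :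
  critical k G <->
  exists (S T A B : {set 'Z_(2 * k + 1)}) (G1 G2 : tgraph),
    [/\ [/\ S != set0, T != set0, A != set0 & B != set0],
        [/\ symmetric_set S, symmetric_set T, symmetric_set A & symmetric_set B],
        [/\ S :&: T = set0, A \subset T & B \subset S],
        forcing_family S A G1 /\ forcing_family T B G2
      & isomorphic G (parallel_sum G1 G2)].
Proof.
case: hG => s [t [hst sp]].
apply: (iff_trans (criticalE _ (tseries_parallel_no_isolated sp))); split.
  move=> cr; have [G1 [G2 [sp1 sp2 iso]]] := edge_critical_parallel sp cr.
  have [S0 T0 dis f1 f2] := edge_critical_forcing sp1 sp2
    (edge_critical_iso (isomorphic_sym iso) cr).
  exists (values k G1), (values k G2), (values k G2), (values k G1), G1, G2.
  by split=> //; split; rewrite ?subxx //; try exact: values_symmetric;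
    apply/eqP; rewrite setI_eq0.
case=> S [T [A [B [G1 [G2 [_ _ [/eqP dis AT BS] [f1 f2] iso]]]]]].
apply: edge_critical_iso iso _.
by apply: forcing_edge_critical f1 f2; rewrite -?setI_eq0.
Qed.
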